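(* Let $(\mathscr{K},\otimes,1)$ be a tensor triangulated category. Then $(\operatorname{Spc}(\mathscr{K}),\operatorname{supp})$ is a support data on $\mathscr{K}$, and it is the final one: for any support data $(X,\sigma)$ on $\mathscr{K}$ there exists a unique continuous map $f:X\to\operatorname{Spc}(\mathscr{K})$ such that $\sigma(a)=f^{-1}(\operatorname{supp}(a))$ for every object $a\in\mathscr{K}$. Explicitly, the map $f$ is given, for all $x\in X$, by $f(x)=\{a\in\mathscr{K}\mid x\notin\sigma(a)\}$.
   Context: All categories are essentially small. A tensor triangulated category $(\mathscr{K},\otimes,1)$ is a triangulated category $\mathscr{K}$ (translation functor $T$) with a symmetric monoidal product $\otimes:\mathscr{K}\times\mathscr{K}\to\mathscr{K}$ which is exact in each variable, with unit $1$. A thick $\otimes$-ideal of $\mathscr{K}$ is a full subcategory $\mathscr{A}$ containing $0$ such that: (a) for any distinguished triangle $a\to b\to c\to Ta$, if two of $a,b,c$ belong to $\mathscr{A}$ then so does the third; (b) if $a\in\mathscr{A}$ and $a\simeq b\oplus c$ in $\mathscr{K}$ then $b,c\in\mathscr{A}$; (c) if $a\in\mathscr{A}$ and $b\in\mathscr{K}$ then $a\otimes b\in\mathscr{A}$. A prime of $\mathscr{K}$ is a thick $\otimes$-ideal $\mathscr{P}\subsetneq\mathscr{K}$ such that $a\otimes b\in\mathscr{P}$ implies $a\in\mathscr{P}$ or $b\in\mathscr{P}$. $\operatorname{Spc}(\mathscr{K})$ is the set of all primes of $\mathscr{K}$, with the Zariski topology, whose closed subsets are the sets $Z(\mathscr{S})=\{\mathscr{P}\in\operatorname{Spc}(\mathscr{K})\mid\mathscr{S}\cap\mathscr{P}=\varnothing\}$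 for collections of objects $\mathscr{S}\subset\mathscr{K}$. For an object $a$, $\operatorname{supp}(a)=Z(\{a\})=\{\mathscr{P}\in\operatorname{Spc}(\mathscr{K})\mid a\notin\mathscr{P}\}$. A support data on $\mathscr{K}$ is a pair $(X,\sigma)$ where $X$ is a topological space and $\sigma$ assigns to each object $a\in\mathscr{K}$ a closed subset $\sigma(a)\subset X$ such that: (SD1) $\sigma(0)=\varnothing$ and $\sigma(1)=X$; (SD2) $\sigma(a\oplus b)=\sigma(a)\cup\sigma(b)$; (SD3) $\sigma(Ta)=\sigma(a)$; (SD4) $\sigma(a)\subset\sigma(b)\cup\sigma(c)$ for any distinguished triangle $a\to b\to c\to Ta$; (SD5) $\sigma(a\otimes b)=\sigma(a)\cap\sigma(b)$. *)

(* Defs.v *)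
From HB Require Import structures.
From mathcomp Require Import all_boot all_algebra.
From mathcomp Require Import all_classical topology_structure.

Set Implicit Arguments.
Unset Strict Implicit.
Unset Printing Implicit Defensive.

Import GRing.Theory.
Local Open Scope classical_set_scope.
Local Open Scope ring_scope.

Reserved Notation "g \oc f" (at level 50, left associativity).
Reserved Notation "a \oplus b" (at level 50, left associativity).
Reserved Notation "a \otimes b" (at level 40, left associativity).

(** Objects and morphisms live in types, so that every category is small.
    [zmodType] includes a choice structure, which by classical choice exists on
    every abelian group. *)
Record additiveCategory := AdditiveCategory {
  obj :> Type;
  mor : obj -> obj -> zmodType;
  idm : forall a, mor a a;
  compm : forall a b c, mor b c -> mor a b -> mor a c;
  comp1m : forall a b (f : mor a b), compm (idm b) f = f;
  compm1 : forall a b (f : mor a b), compm f (idm a) = f;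
  compmA : forall a b c d (h : mor c d) (g : mor b c) (f : mor a b),
    compm h (compm g f) = compm (compm h g) f;
  compmDl : forall a b c (g g' : mor b c) (f : mor a b),
    compm (g + g') f = compm g f + compm g' f;
  compmDr : forall a b c (g : mor b c) (f f' : mor a b),
    compm g (f + f') = compm g f + compm g f';
  zero_obj : obj;
  zero_obj_initial : forall a (f : mor zero_obj a), f = 0;
  zero_obj_terminal : forall a (f : mor a zero_obj), f = 0;
  dsum : obj -> obj -> obj;
  inj1 : forall a b, mor a (dsum a b);
  inj2 : forall a b, mor b (dsum a b);
  prj1 : forall a b, mor (dsum a b) a;
  prj2 : forall a b, mor (dsum a b) b;
  prj1_inj1 : forall a b, compm (prj1 a b) (inj1 a b) = idm a;
  prj2_inj2 : forall a b, compm (prj2 a b) (inj2 a b) = idm b;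
  prj1_inj2 : forall a b, compm (prj1 a b) (inj2 a b) = 0;
  prj2_inj1 : forall a b, compm (prj2 a b) (inj1 a b) = 0;
  dsum_id : forall a b,
    compm (inj1 a b) (prj1 a b) + compm (inj2 a b) (prj2 a b) = idm (dsum a b)
}.

Arguments mor {a} _ _ : rename.
Arguments idm {a} _ : rename.
Arguments zero_obj {a} : rename.
Arguments inj1 {a} _ _ : rename.
Arguments inj2 {a} _ _ : rename.
Arguments prj1 {a} _ _ : rename.
Arguments prj2 {a} _ _ : rename.
Notation "g \oc f" := (compm g f).
Notation "a \oplus b" := (dsum a b).

Definition is_iso (C : additiveCategory) (a b : C) (f : mor a b) : Prop :=
  exists g : mor b a, g \oc f = idm a /\ f \oc g = idm b.

Definition isomorphic (C : additiveCategory) (a b : C) : Prop :=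
  exists f : mor a b, is_iso f.

Record functor (C D : additiveCategory) := Functor {
  fob :> C -> D;
  fmor : forall a b, mor a b -> mor (fob a) (fob b);
  fmap_id : forall a, fmor (idm a) = idm (fob a);
  fmap_comp : forall a b c (g : mor b c) (f : mor a b),
    fmor (g \oc f) = fmor g \oc fmor f
}.

Arguments fmor {C D} f {a b} _ : rename.

Definition additive_functor (C D : additiveCategory) (F : functor C D) : Prop :=
  forall (a b : C) (f g : mor a b), fmor F (f + g) = fmor F f + fmor F g.

Definition id_functor (C : additiveCategory) : functor C C :=
  @Functor C C (fun a => a) (fun _ _ f => f) (fun _ => erefl)
    (fun _ _ _ _ _ => erefl).

Section CompFunctor.
Variables (C D E : additiveCategory) (G : functor D E) (F : functor C D).

Lemma comp_functor_id (a : C) : fmor G (fmor F (idm a)) = idm (G (F a)).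
Proof. by rewrite !fmap_id. Qed.

Lemma comp_functor_comp (a b c : C) (g : mor b c) (f : mor a b) :
  fmor G (fmor F (g \oc f)) = fmor G (fmor F g) \oc fmor G (fmor F f).
Proof. by rewrite !fmap_comp. Qed.

Definition comp_functor : functor C E :=
  @Functor C E (fun a => G (F a)) (fun _ _ f => fmor G (fmor F f))
    comp_functor_id comp_functor_comp.

End CompFunctor.

Definition natural_iso (C D : additiveCategory) (F G : functor C D)
    (t : forall a, mor (F a) (G a)) : Prop :=
  (forall a, is_iso (t a)) /\
  (forall a b (f : mor a b), t b \oc fmor F f = fmor G f \oc t a).

Definition naturally_isomorphic (C D : additiveCategory) (F G : functor C D) :
  Prop := exists t : forall a, mor (F a) (G a), natural_iso t.

Definition is_equivalence (C D : additiveCategory) (F : functor C D) : Prop :=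
  exists G : functor D C,
    naturally_isomorphic (comp_functor G F) (id_functor C) /\
    naturally_isomorphic (comp_functor F G) (id_functor D).

(** [dist u v w] says that a --u--> b --v--> c --w--> T a is distinguished. *)
Record triangulatedCategory := TriangulatedCategory {
  tr_cat :> additiveCategory;
  T : functor tr_cat tr_cat;
  T_additive : additive_functor T;
  T_equivalence : is_equivalence T;
  dist : forall a b c : tr_cat, mor a b -> mor b c -> mor c (T a) -> Prop;
  dist_iso : forall (a b c a' b' c' : tr_cat)
      (u : mor a b) (v : mor b c) (w : mor c (T a))
      (u' : mor a' b') (v' : mor b' c') (w' : mor c' (T a'))
      (f : mor a a') (g : mor b b') (h : mor c c'),
    is_iso f -> is_iso g -> is_iso h ->
    g \oc u = u' \oc f -> h \oc v = v' \oc g -> fmor T f \oc w = w' \oc h ->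
    dist u v w -> dist u' v' w';
  dist_id : forall a : tr_cat,
    dist (idm a) (0 : mor a zero_obj) (0 : mor zero_obj (T a));
  dist_cone : forall (a b : tr_cat) (u : mor a b),
    exists (c : tr_cat) (v : mor b c) (w : mor c (T a)), dist u v w;
  dist_rotate : forall (a b c : tr_cat)
      (u : mor a b) (v : mor b c) (w : mor c (T a)),
    dist u v w <-> dist v w (- fmor T u);
  dist_morphism : forall (a b c a' b' c' : tr_cat)
      (u : mor a b) (v : mor b c) (w : mor c (T a))
      (u' : mor a' b') (v' : mor b' c') (w' : mor c' (T a'))
      (f : mor a a') (g : mor b b'),
    dist u v w -> dist u' v' w' -> g \oc u = u' \oc f ->
    exists h : mor c c', h \oc v = v' \oc g /\ fmor T f \oc w = w' \oc h;
  dist_octahedron : forall (a b c a' b' c' : tr_cat)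
      (u : mor a b) (i : mor b c') (j : mor c' (T a))
      (v : mor b c) (k : mor c a') (l : mor a' (T b))
      (m : mor c b') (n : mor b' (T a)),
    dist u i j -> dist v k l -> dist (v \oc u) m n ->
    exists (f : mor c' b') (g : mor b' a'),
      [/\ dist f g (fmor T i \oc l),
          f \oc i = m \oc v, n \oc f = j,
          g \oc m = k & l \oc g = fmor T u \oc n]
}.

Arguments T {t} : rename.

Definition exact_functor (K L : triangulatedCategory) (F : functor K L) :
    Prop :=
  additive_functor F /\
  exists t : forall a : K, mor (F (T a)) (T (F a)),
    natural_iso (F := comp_functor F T) (G := comp_functor T F) t /\
    forall (a b c : K) (u : mor a b) (v : mor b c) (w : mor c (T a)),
      dist u v w -> dist (fmor F u) (fmor F v) (t a \oc fmor F w).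

Record bifunctor (C : additiveCategory) := Bifunctor {
  bob :> C -> C -> C;
  bmap : forall a a' b b' : C,
    mor a a' -> mor b b' -> mor (bob a b) (bob a' b');
  bmap_id : forall a b : C, bmap (idm a) (idm b) = idm (bob a b);
  bmap_comp : forall (a a' a'' b b' b'' : C)
      (f' : mor a' a'') (f : mor a a') (g' : mor b' b'') (g : mor b b'),
    bmap (f' \oc f) (g' \oc g) = bmap f' g' \oc bmap f g
}.

Arguments bmap {C} b {a a' b0 b'} _ _ : rename.

Section PartialFunctors.
Variables (C : additiveCategory) (B : bifunctor C).

Lemma bifunctor_l_comp (b a a' a'' : C) (g : mor a' a'') (f : mor a a') :
  bmap B (g \oc f) (idm b) = bmap B g (idm b) \oc bmap B f (idm b).
Proof. by rewrite -bmap_comp comp1m. Qed.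

Definition bifunctor_l (b : C) : functor C C :=
  @Functor C C (fun a => B a b) (fun _ _ f => bmap B f (idm b))
    (fun a => bmap_id B a b) (@bifunctor_l_comp b).

Lemma bifunctor_r_comp (a b b' b'' : C) (g : mor b' b'') (f : mor b b') :
  bmap B (idm a) (g \oc f) = bmap B (idm a) g \oc bmap B (idm a) f.
Proof. by rewrite -bmap_comp comp1m. Qed.

Definition bifunctor_r (a : C) : functor C C :=
  @Functor C C (fun b => B a b) (fun _ _ f => bmap B (idm a) f)
    (fun b => bmap_id B a b) (@bifunctor_r_comp a).

End PartialFunctors.

Record symmetricMonoidal (C : additiveCategory) := SymmetricMonoidal {
  sm_tensor : bifunctor C;
  sm_unit : C;
  sm_assoc : forall a b c : C,
    mor (sm_tensor (sm_tensor a b) c) (sm_tensor a (sm_tensor b c));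
  sm_lunit : forall a : C, mor (sm_tensor sm_unit a) a;
  sm_runit : forall a : C, mor (sm_tensor a sm_unit) a;
  sm_sym : forall a b : C, mor (sm_tensor a b) (sm_tensor b a);
  sm_assoc_iso : forall a b c, is_iso (sm_assoc a b c);
  sm_lunit_iso : forall a, is_iso (sm_lunit a);
  sm_runit_iso : forall a, is_iso (sm_runit a);
  sm_assoc_nat : forall (a a' b b' c c' : C)
      (f : mor a a') (g : mor b b') (h : mor c c'),
    sm_assoc a' b' c' \oc bmap sm_tensor (bmap sm_tensor f g) h =
    bmap sm_tensor f (bmap sm_tensor g h) \oc sm_assoc a b c;
  sm_lunit_nat : forall (a a' : C) (f : mor a a'),
    sm_lunit a' \oc bmap sm_tensor (idm sm_unit) f = f \oc sm_lunit a;
  sm_runit_nat : forall (a a' : C) (f : mor a a'),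
    sm_runit a' \oc bmap sm_tensor f (idm sm_unit) = f \oc sm_runit a;
  sm_sym_nat : forall (a a' b b' : C) (f : mor a a') (g : mor b b'),
    sm_sym a' b' \oc bmap sm_tensor f g = bmap sm_tensor g f \oc sm_sym a b;
  sm_pentagon : forall a b c d : C,
    sm_assoc a b (sm_tensor c d) \oc sm_assoc (sm_tensor a b) c d =
    bmap sm_tensor (idm a) (sm_assoc b c d)
      \oc sm_assoc a (sm_tensor b c) d
      \oc bmap sm_tensor (sm_assoc a b c) (idm d);
  sm_triangle : forall a b : C,
    bmap sm_tensor (idm a) (sm_lunit b) \oc sm_assoc a sm_unit b =
    bmap sm_tensor (sm_runit a) (idm b);
  sm_hexagon : forall a b c : C,
    sm_assoc b c a \oc sm_sym a (sm_tensor b c) \oc sm_assoc a b c =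
    bmap sm_tensor (idm b) (sm_sym a c)
      \oc sm_assoc b a c
      \oc bmap sm_tensor (sm_sym a b) (idm c);
  sm_symK : forall a b : C, sm_sym b a \oc sm_sym a b = idm (sm_tensor a b)
}.

Record ttCategory := TTCategory {
  tt_cat :> triangulatedCategory;
  tt_monoidal : symmetricMonoidal tt_cat;
  tensor_exact_l : forall b : tt_cat,
    exact_functor (K := tt_cat) (L := tt_cat)
      (bifunctor_l (sm_tensor tt_monoidal) b);
  tensor_exact_r : forall a : tt_cat,
    exact_functor (K := tt_cat) (L := tt_cat)
      (bifunctor_r (sm_tensor tt_monoidal) a)
}.

Definition tensor (K : ttCategory) : K -> K -> K := sm_tensor (tt_monoidal K).
Definition unit_obj (K : ttCategory) : K := sm_unit (tt_monoidal K).
Arguments unit_obj {K}.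
Notation "a \otimes b" := (tensor a b).

Record thick_ideal (K : ttCategory) (A : set K) : Prop := ThickIdeal {
  thick0 : A zero_obj;
  thick_triangle : forall (a b c : K)
      (u : mor a b) (v : mor b c) (w : mor c (T a)),
    dist u v w ->
    [/\ A a -> A b -> A c, A b -> A c -> A a & A a -> A c -> A b];
  thick_summand : forall a b c : K,
    A a -> isomorphic a (b \oplus c) -> A b /\ A c;
  thick_tensor : forall a b : K, A a -> A (a \otimes b)
}.

Record is_prime (K : ttCategory) (P : set K) : Prop := IsPrime {
  prime_thick : thick_ideal P;
  prime_proper : P <> setT;
  prime_tensor : forall a b : K, P (a \otimes b) -> P a \/ P b
}.

Record Spc (K : ttCategory) := MkSpc {
  prime_set :> set K;
  prime_setP : is_prime prime_set
}.

Definition Zlocus (K : ttCategory) (S : set K) : set (Spc K) :=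
  [set P : Spc K | S `&` P = set0].

Definition supp (K : ttCategory) (a : K) : set (Spc K) := Zlocus [set a].

Section Triangulated.
Variable K : triangulatedCategory.

Lemma comp0m (a b c : K) (f : mor a b) : (0 : mor b c) \oc f = 0.
Proof. by apply: (addrI (0 \oc f)); rewrite -compmDl !addr0. Qed.

Lemma compm0 (a b c : K) (g : mor b c) : g \oc (0 : mor a b) = 0.
Proof. by apply: (addrI (g \oc 0)); rewrite -compmDr !addr0. Qed.

Lemma compNm (a b c : K) (g : mor b c) (f : mor a b) :
  (- g) \oc f = - (g \oc f).
Proof.
by apply: (addrI (g \oc f)); rewrite -compmDl !subrr comp0m.
Qed.

Lemma compmN (a b c : K) (g : mor b c) (f : mor a b) :
  g \oc (- f) = - (g \oc f).
Proof.
by apply: (addrI (g \oc f)); rewrite -compmDr !subrr compm0.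
Qed.

Lemma is_iso_id (a : K) : is_iso (idm a).
Proof. by exists (idm a); rewrite comp1m. Qed.

Lemma fmapT0 (a b : K) : fmor T (0 : mor a b) = 0.
Proof. by apply: (addrI (fmor T 0)); rewrite -T_additive !addr0. Qed.

Lemma T_zero (b : K) (f : mor (T zero_obj) b) : f = 0.
Proof.
rewrite -[f]compm1 -fmap_id (zero_obj_initial (idm zero_obj)) fmapT0.
exact: compm0.
Qed.

Lemma dist_0id (x : K) :
  dist (0 : mor zero_obj x) (idm x) (0 : mor x (T zero_obj)).
Proof.
apply/dist_rotate; rewrite fmapT0 oppr0.
apply: (dist_iso (h := (0 : mor zero_obj (T zero_obj)))
  (is_iso_id x) (is_iso_id x) _ _ _ _ (dist_id x)).
- exists (0 : mor (T zero_obj) zero_obj); split.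
    by rewrite (zero_obj_initial (idm _)) compm0.
  by rewrite (T_zero (idm _)) comp0m.
- by [].
- by rewrite !compm0 compm1.
- by rewrite fmap_id comp1m compm0.
Qed.

Lemma dist_comp0 (a b c : K) (u : mor a b) (v : mor b c) (w : mor c (T a)) :
  dist u v w -> v \oc u = 0.
Proof.
move=> tr; have [] := dist_morphism (dist_id a) tr (f := idm a) (g := u).
  by rewrite !compm1.
by move=> h [<- _]; rewrite compm0.
Qed.

Lemma dist_weak_cokernel (a b c x : K)
    (u : mor a b) (v : mor b c) (w : mor c (T a)) (g : mor b x) :
  dist u v w -> g \oc u = 0 -> exists h : mor c x, h \oc v = g.
Proof.
move=> tr gu0.
have [] := dist_morphism tr (dist_0id x) (f := (0 : mor a zero_obj)) (g := g).
  by rewrite gu0 compm0.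
by move=> h [hv _]; exists h; rewrite hv comp1m.
Qed.

Lemma dist_dsum (a b : K) : dist (inj1 a b) (prj2 a b) (0 : mor b (T a)).
Proof.
have [c [v [w tr]]] := dist_cone (inj1 a b).
have tr' := tr; move/dist_rotate in tr'.
have tr'' := tr'; move/dist_rotate in tr''.
have w0 : w = 0.
  have := dist_comp0 tr''; rewrite compNm => /eqP; rewrite oppr_eq0 => /eqP e.
  rewrite -[w]comp1m -fmap_id -(prj1_inj1 a b) fmap_comp -compmA e.
  exact: compm0.
have [h hv] := dist_weak_cokernel tr (prj2_inj1 a b).
pose k := v \oc inj2 a b.
have hk : h \oc k = idm b by rewrite /k compmA hv prj2_inj2.
have kh : k \oc h = idm c.
  have e : (k \oc h - idm c) \oc v = 0.
    rewrite compmDl -compmA hv compNm comp1m /k -[X in _ - X]compm1.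
    rewrite -(dsum_id a b) compmDr !compmA (dist_comp0 tr) comp0m add0r.
    by rewrite subrr.
  have [r rw] := dist_weak_cokernel tr' e.
  by apply/eqP; rewrite -subr_eq0 -rw w0 compm0.
apply: (dist_iso (is_iso_id a) (is_iso_id _) _ _ _ _ tr).
- by exists k; split; [exact: kh | exact: hk].
- by rewrite comp1m compm1.
- by rewrite compm1.
- by rewrite w0 compm0 comp0m.
Qed.

End Triangulated.

Section Zariski.
Variable K : ttCategory.
Implicit Types (P : Spc K) (S : set K) (a b : K).

Lemma ZlocusP S P : Zlocus S P <-> forall a, S a -> ~ prime_set P a.
Proof.
split=> [SP0 a Sa Pa | SP].
  by have : (S `&` P) a by []; rewrite SP0.
by apply/seteqP; split=> // a [/SP].
Qed.

Lemma suppP a P : supp a P <-> ~ prime_set P a.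
Proof.
split=> [/ZlocusP /(_ a erefl)//|nPa].
by apply/ZlocusP => b ->.
Qed.

Lemma prime_dsum P a b :
  prime_set P (a \oplus b) <-> prime_set P a /\ prime_set P b.
Proof.
have [Pt _ _] := prime_setP P; split=> [Pab | [Pa Pb]].
  apply: (thick_summand Pt Pab).
  by exists (idm _); exact: is_iso_id.
by have [_ _] := thick_triangle Pt (dist_dsum a b); apply.
Qed.

Definition zariski_open : set (set (Spc K)) :=
  [set U | exists S, ~` U = Zlocus S].

Lemma zariski_openT : zariski_open setT.
Proof.
exists setT; apply/seteqP; split=> [P /(_ I)//|P /ZlocusP /(_ zero_obj I) []].
by have [Pt _ _] := prime_setP P; exact: thick0 Pt.
Qed.

Lemma zariski_openI : setI_closed zariski_open.
Proof.
move=> U V [S US] [S' VS']; rewrite /zariski_open /=.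
exists [set c | exists a b, [/\ S a, S' b & c = a \oplus b]].
rewrite setCI US VS'; apply/seteqP; split=> P.
  case=> /ZlocusP SP; apply/ZlocusP => _ [a [b [Sa S'b ->]]];
    move=> /prime_dsum [Pa Pb]; [exact: SP Pa | exact: SP Pb].
move=> /ZlocusP SSP; have [SP|] := pselect (Zlocus S P); first by left.
move=> nSP; right; have [a Sa Pa] : exists2 a, S a & prime_set P a.
  apply: contrapT => nex; apply: nSP; apply/ZlocusP => a Sa Pa.
  by apply: nex; exists a.
apply/ZlocusP => b S'b Pb; apply: (SSP (a \oplus b)); first by exists a, b.
exact/prime_dsum.
Qed.

Lemma zariski_open_bigU (I : Type) (f : I -> set (Spc K)) :
  (forall i, zariski_open (f i)) -> zariski_open (\bigcup_i f i).
Proof.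
move=> fS; exists [set a | exists i, ~` f i `<=` supp a].
apply/seteqP; split=> P.
  move=> nfP; apply/ZlocusP => a [i fia]; apply/suppP/fia => fiP.
  by apply: nfP; exists i.
move=> /ZlocusP SP [i _ fiP]; have [S fiS] := fS i.
have : ~ (~` f i) P by move=> /(_ fiP).
rewrite fiS; apply; apply/ZlocusP => a Sa; apply: SP; exists i.
by rewrite fiS => Q /ZlocusP /(_ a Sa) nQa; apply/suppP.
Qed.

HB.instance Definition _ := gen_eqMixin (Spc K).
HB.instance Definition _ := gen_choiceMixin (Spc K).
HB.instance Definition _ :=
  isOpenTopological.Build (Spc K)
    zariski_openT zariski_openI zariski_open_bigU.

Lemma zariski_closedE (C : set (Spc K)) : closed C <-> exists S, C = Zlocus S.
Proof.
by rewrite -openC; split=> -[S]; rewrite ?setCK; exists S; rewrite ?setCK.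
Qed.

End Zariski.

Record support_data (K : ttCategory) (X : topologicalType)
    (sigma : K -> set X) : Prop := SupportData {
  sd_closed : forall a, closed (sigma a);
  sd_zero : sigma zero_obj = set0;
  sd_unit : sigma unit_obj = setT;
  sd_dsum : forall a b, sigma (a \oplus b) = sigma a `|` sigma b;
  sd_shift : forall a, sigma (T a) = sigma a;
  sd_triangle : forall (a b c : K)
      (u : mor a b) (v : mor b c) (w : mor c (T a)),
    dist u v w -> sigma a `<=` sigma b `|` sigma c;
  sd_tensor : forall a b, sigma (a \otimes b) = sigma a `&` sigma b
}.

(* Main.v *)
Require Import Defs.

From mathcomp Require Import all_boot ssralg.
From mathcomp Require Import all_classical topology_structure.

Set Implicit Arguments.
Unset Strict Implicit.

Local Open Scope classical_set_scope.

(** A prime is determined by the set of objects outside it, that is, by the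
    family of conditions [supp a P].  Hence a map [f] into the spectrum with
    [sigma a = f @^-1` (supp a)] can only be [f x = {a | ~ sigma a x}], which
    gives both the formula and uniqueness.

    For existence one reads the axioms of a support data as statements about
    that set of objects: the values at [0] and [1] say that it contains [0] and
    not [1], the shift and triangle axioms that it has the two-out-of-three
    property for triangles, the direct sum axiom that it is closed under direct
    summands, and the tensor axiom that it is a prime tensor ideal.
    Conversely, reading the axioms of a prime in the same way shows that [supp]
    is a support data.  Continuity holds because the closed subsets of the
    spectrum are intersections of supports, whose preimages are the closed sets
    [sigma a].

    The one categorical ingredient is that prime ideals and support data are
    invariant under isomorphism.  Both facts come from the distinguished triangle
    [a -> b -> 0 -> T a] on an isomorphism [a -> b] ([dist_of_iso]). *)

Lemma dist_of_iso (K : triangulatedCategory) (a b : K) (u : mor a b) :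
  is_iso u ->
  dist u (0%R : mor b zero_obj) (0%R : mor zero_obj (T a)).
Proof.
move=> u_iso.
apply: (dist_iso (is_iso_id a) u_iso (is_iso_id zero_obj) _ _ _ (dist_id a)).
- by [].
- by rewrite compm0 comp0m.
- by rewrite compm0 comp0m.
Qed.

Lemma thick_iso (K : ttCategory) (A : set K) (a b : K) :
  thick_ideal A -> isomorphic a b -> A a -> A b.
Proof.
move=> At [u /dist_of_iso tr] Aa.
by have [_ _] := thick_triangle At tr; apply=> //; exact: thick0 At.
Qed.

(** The triangle [a -> 0 -> T a], a rotation of the one on the identity of [a],
    makes [a] and [T a] lie in the same thick ideals. *)
Lemma thick_shift (K : ttCategory) (A : set K) (a : K) :
  thick_ideal A -> A (T a) <-> A a.
Proof.
move=> At; have /dist_rotate/(thick_triangle At) [Ac Aa _] := dist_id a.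
by have A0 := thick0 At; split=> ?; [exact: Aa | exact: Ac].
Qed.

(** An ideal containing [1] contains every [a], as [1 \otimes a] is isomorphic
    to [a]. *)
Lemma prime_unitN (K : ttCategory) (P : set K) : is_prime P -> ~ P unit_obj.
Proof.
move=> [Pt Pproper _] P1; apply: Pproper; apply/seteqP; split=> // a _.
apply: (thick_iso Pt _ (thick_tensor Pt a P1)).
by exists (sm_lunit (tt_monoidal K) a); exact: sm_lunit_iso.
Qed.

Lemma prime_tensorE (K : ttCategory) (P : set K) (a b : K) :
  is_prime P -> P (a \otimes b) <-> P a \/ P b.
Proof.
move=> [Pt _ Pprime]; split=> [|[Pa|Pb]]; first exact: Pprime.
  exact: thick_tensor.
(* Ideals absorb on the right only; the symmetry gives the other side. *)
apply: (thick_iso Pt _ (thick_tensor Pt a Pb)).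
exists (sm_sym (tt_monoidal K) b a).
by exists (sm_sym (tt_monoidal K) a b); split; exact: sm_symK.
Qed.

Lemma supp_support_data (K : ttCategory) : support_data (@supp K).
Proof.
split.
- by move=> a; apply/zariski_closedE; exists [set a].
- apply/seteqP; split=> // P /suppP; apply.
  by have [Pt _ _] := prime_setP P; exact: thick0 Pt.
- apply/seteqP; split=> // P _; apply/suppP.
  exact: prime_unitN (prime_setP P).
- move=> a b; apply/seteqP; split=> P.
    move=> /suppP; rewrite prime_dsum => /not_andP [nPa|nPb].
      by left; apply/suppP.
    by right; apply/suppP.
  by move=> [] /suppP nP; apply/suppP => /prime_dsum [].
- move=> a; have eqP (P : Spc K) : prime_set P (T a) <-> prime_set P a.
    by have [Pt _ _] := prime_setP P; exact: thick_shift.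
  by apply/seteqP; split=> P /suppP nP; apply/suppP; rewrite ?eqP // -eqP.
- move=> a b c u v w tr P /suppP nPa; apply: contrapT.
  move=> /not_orP [/suppP /contrapT Pb /suppP /contrapT Pc].
  have [Pt _ _] := prime_setP P.
  by have [_ PbcPa _] := thick_triangle Pt tr; exact/nPa/PbcPa.
- move=> a b; apply/seteqP; split=> P.
    move=> /suppP; rewrite (prime_tensorE _ _ (prime_setP P)).
    by move=> /not_orP [nPa nPb]; split; apply/suppP.
  move=> [/suppP nPa /suppP nPb]; apply/suppP.
  by rewrite (prime_tensorE _ _ (prime_setP P)) => -[].
Qed.

Section SupportData.
Variables (K : ttCategory) (X : topologicalType) (sigma : K -> set X).
Hypothesis sd : support_data sigma.

(** Rotating a triangle replaces a vertex by its shift, which has the same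
    [sigma]; so the triangle axiom bounds each vertex by the two others. *)
Lemma sd_triangle2 (a b c : K) (u : mor a b) (v : mor b c) (w : mor c (T a)) :
  dist u v w -> sigma b `<=` sigma a `|` sigma c.
Proof.
by move=> /dist_rotate/(sd_triangle sd); rewrite (sd_shift sd) setUC.
Qed.

Lemma sd_triangle3 (a b c : K) (u : mor a b) (v : mor b c) (w : mor c (T a)) :
  dist u v w -> sigma c `<=` sigma a `|` sigma b.
Proof.
by move=> /dist_rotate/sd_triangle2; rewrite (sd_shift sd) setUC.
Qed.

Lemma sd_iso (a b : K) : isomorphic a b -> sigma b = sigma a.
Proof.
move=> [u /dist_of_iso tr].
have := sd_triangle2 tr; have := sd_triangle sd tr.
by rewrite (sd_zero sd) !setU0 => ab ba; apply/seteqP.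
Qed.

Lemma vanishing_is_prime (x : X) : is_prime [set a : K | ~ sigma a x].
Proof.
split; first split=> /=.
- by rewrite (sd_zero sd).
- move=> a b c u v w tr.
  split=> na nb n.
  + by case: (sd_triangle3 tr n).
  + by case: (sd_triangle sd tr n).
  + by case: (sd_triangle2 tr n).
- move=> a b c na /sd_iso; rewrite (sd_dsum sd) => bc.
  by split=> n; apply: na; rewrite -bc; [left | right].
- by move=> a b na; rewrite (sd_tensor sd) => -[].
- move=> allT; have : [set a : K | ~ sigma a x] unit_obj by rewrite allT.
  by rewrite /= (sd_unit sd); apply.
- by move=> a b /=; rewrite (sd_tensor sd) => /not_andP.
Qed.

Definition vanishing_prime (x : X) : Spc K :=
  {| prime_set := [set a : K | ~ sigma a x];
     prime_setP := vanishing_is_prime x |}.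

Lemma preimage_supp_vanishing (a : K) :
  sigma a = vanishing_prime @^-1` supp a.
Proof.
by apply/seteqP; split=> x /= => [sax|/suppP /contrapT //]; apply/suppP => /=.
Qed.

End SupportData.

(** Supports form a basis of closed sets, because [Zlocus S] is the intersection
    of the supports of the members of [S]. *)
Lemma Spc_continuous (K : ttCategory) (X : topologicalType) (g : X -> Spc K) :
  (forall a : K, closed (g @^-1` supp a)) -> continuous g.
Proof.
move=> g_closed; apply/continuous_closedP => C /zariski_closedE [S ->].
have -> : g @^-1` Zlocus S = \bigcap_(a in S) (g @^-1` supp a).
  apply/seteqP; split=> x /=.
    by move=> /ZlocusP Sx a Sa; apply/suppP; exact: Sx.
  by move=> Sx; apply/ZlocusP => a /Sx /suppP.
by apply: closed_bigI => a _; exact: g_closed.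
Qed.

Lemma Spc_ext (K : ttCategory) (P Q : Spc K) :
  (forall a : K, supp a P <-> supp a Q) -> P = Q.
Proof.
move=> PQ; have : prime_set P = prime_set Q.
  apply/seteqP; split=> a Ra; apply: contrapT => /suppP nRa.
    by have /suppP := (PQ a).2 nRa; apply.
  by have /suppP := (PQ a).1 nRa; apply.
case: P Q {PQ} => [P Pp] [Q Qp] /= PQ; case: _ / PQ in Qp *.
by congr MkSpc; exact: Prop_irrelevance.
Qed.

Theorem theorem3p2 (K : ttCategory) :
  support_data (@supp K) /\
  forall (X : topologicalType) (sigma : K -> set X), support_data sigma ->
    exists f : X -> Spc K,
      unique (fun g : X -> Spc K =>
        continuous g /\ forall a : K, sigma a = g @^-1` (supp a)) f /\
      forall x : X, prime_set (f x) = [set a : K | ~ sigma a x].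
Proof.
split; first exact: supp_support_data.
move=> X sigma sd; exists (vanishing_prime sd); split=> //; split.
  split; last exact: preimage_supp_vanishing.
  apply: Spc_continuous => a.
  by rewrite -preimage_supp_vanishing; exact: sd_closed sd a.
move=> g [_ g_supp]; apply/funext => x; apply: Spc_ext => a.
rewrite -[supp a (g x)]/((g @^-1` supp a) x) -g_supp.
by rewrite [in X in _ <-> X](preimage_supp_vanishing sd a).
Qed.
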